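(* Let $\mathbb{H}$ be a Hilbert space and let $E:\mathbb{H}\to[0,\infty)$ be a $C^1$-functional for which there is a constant $C_0>0$ with $$\|\mathbf{u}-\mathbf{v}\|^2\le C_0\,(E(\mathbf{u})+E(\mathbf{v}))\quad\text{for every pair }\mathbf{u},\mathbf{v}\in\mathbb{H}.$$ Suppose there is a locally Lipschitz operator $\mathbf{T}:\mathbb{H}\to\mathbb{H}$ and a constant $d>0$ such that $$\langle E'(\mathbf{u}),\mathbf{T}\mathbf{u}\rangle=-d\,E(\mathbf{u})\quad\text{for every }\mathbf{u}\in\mathbb{H}.$$ Then $E$ is an error functional, and, consequently, there is a unique global minimizer $\mathbf{u}_\infty\in\mathbb{H}$ with $E(\mathbf{u}_\infty)=0$, and $$\|\mathbf{u}-\mathbf{u}_\infty\|^2\le C\,E(\mathbf{u})$$ for some constant $C$ and every $\mathbf{u}\in\mathbb{H}$.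
   Context: A non-negative $C^1$-functional $E:\mathbb{H}\to[0,\infty)$ defined over a Hilbert space $\mathbb{H}$ is called an error functional if: (1) (behavior as $E'\to\mathbf{0}$) $\lim_{E'(\mathbf{u})\to\mathbf{0}}E(\mathbf{u})=0$ over bounded subsets of $\mathbb{H}$, i.e. for every bounded sequence $\{\mathbf{u}_j\}\subset\mathbb{H}$ with $E'(\mathbf{u}_j)\to\mathbf{0}$ one has $E(\mathbf{u}_j)\to0$; and (2) (enhanced coercivity) there is a constant $C>0$ such that for every pair $\mathbf{u},\mathbf{v}\in\mathbb{H}$, $\|\mathbf{u}-\mathbf{v}\|^2\le C\,(E(\mathbf{u})+E(\mathbf{v}))$. Here $E'(\mathbf{u})$ is the (Fréchet) derivative of $E$ at $\mathbf{u}$.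
   Formalization: ''Locally Lipschitz'' is taken to mean Lipschitz on every bounded subset of H; with the weaker meaning ''Lipschitz near each point'' the claim fails in infinite dimension, since T may then be unbounded on bounded sets. *)

(* Defs.v *)
From HB Require Import structures.
From mathcomp Require Import all_boot all_order all_algebra.
From mathcomp Require Import sesquilinear.
From mathcomp Require Import all_classical all_reals all_analysis.

Set Implicit Arguments.
Unset Strict Implicit.
Unset Printing Implicit Defensive.

Import Order.TTheory GRing.Theory Num.Theory.
Import numFieldNormedType.Exports.

Local Open Scope classical_set_scope.
Local Open Scope ring_scope.

(* The supremum is taken in the extended reals, so that an unbounded functional
   has norm +oo and not a junk value. *)
Definition dual_norm (R : realType) (H : normedModType R) (f : H -> R) : \bar R :=
  ereal_sup [set (`|f h|)%:E | h in [set h : H | `|h| <= 1]].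

Definition C1_functional (R : realType) (H : normedModType R) (E : H -> R) : Prop :=
  (forall u, differentiable E u) /\
  (forall u, dual_norm (fun h => 'd E v h - 'd E u h) @[v --> u] --> 0%E).

Definition small_derivative_behavior (R : realType) (H : normedModType R)
    (E : H -> R) : Prop :=
  forall u_ : nat -> H, bounded_fun u_ ->
    dual_norm ('d E (u_ j)) @[j --> \oo] --> 0%E ->
    E (u_ j) @[j --> \oo] --> 0.

Definition enhanced_coercivity (R : realType) (H : normedModType R)
    (E : H -> R) : Prop :=
  exists C : R, 0 < C /\ forall u v : H, `|u - v| ^+ 2 <= C * (E u + E v).

Definition error_functional (R : realType) (H : normedModType R)
    (E : H -> R) : Prop :=
  [/\ forall u, 0 <= E u, C1_functional E,
      small_derivative_behavior E & enhanced_coercivity E].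

(* "Locally Lipschitz" in the sense usual for operators on infinite-dimensional
   spaces (e.g. Pazy, Semigroups of Linear Operators, section 6.1): Lipschitz on
   every bounded set. In infinite dimension this is stronger than being
   Lipschitz near each point, which does not make the operator bounded on
   bounded sets. *)
Definition locally_lipschitz (R : realType) (V W : normedModType R)
    (T : V -> W) : Prop :=
  forall A : set V, bounded_set A -> [lipschitz T x | x in A].

Definition global_minimizer (R : realType) (X : Type) (E : X -> R) (u : X) : Prop :=
  forall v, E u <= E v.

(* Main.v *)
Require Import Defs.
From HB Require Import structures.
From mathcomp Require Import all_boot all_order all_algebra.
From mathcomp Require Import sesquilinear.
From mathcomp Require Import all_classical all_reals all_analysis.
From mathcomp Require Import ring lra.

Set Implicit Arguments.
Unset Strict Implicit.
Unset Printing Implicit Defensive.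

Import Order.TTheory GRing.Theory Num.Theory.
Import numFieldNormedType.Exports.

Local Open Scope classical_set_scope.
Local Open Scope ring_scope.

(** Along a bounded sequence the Lipschitz operator T stays bounded, by M say,
    so the identity d E(u) = - E'(u)(T u) gives d E(u) <= M |E'(u)|: values of
    E are controlled by its derivative ([small_derivative_of_pairing]). This is
    the first property of error functionals.

    The same identity produces a zero of E, once almost critical points are
    available. Ekeland's variational principle ([ekeland]) supplies them: it
    gives a point u with E(u) <= E(0) at which E has slope at least - eps in
    every direction, so that E'(u)(T u) >= - eps |T u|
    ([diff_ge_of_slope]). Coercivity confines the sublevel set of E(0) to a
    ball chosen before eps, and T is bounded by a fixed M there; hence
    d E(u) <= eps M, and E takes arbitrarily small values
    ([exists_small_value]). By coercivity any sequence with E(x_n) -> 0 is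
    Cauchy, and its limit is a zero of E by continuity ([exists_zero]).

    Coercivity between u and the zero u_inf reads |u - u_inf|^2 <= C0 E(u),
    which is the final estimate and also forces uniqueness of the minimizer.
    Ekeland's principle thus replaces the usual integration of the flow
    u' = T u, along which E decays exponentially. *)

Lemma cvg_of_tail_bound (R : realType) (V : completeNormedModType R)
    (x_ : nat -> V) (b : nat -> R) :
  b n @[n --> \oo] --> 0 ->
  (forall n m, (n <= m)%N -> `|x_ m - x_ n| <= b n) ->
  cvgn x_.
Proof.
move=> b0 xb; apply/cauchy_cvgP/cauchy_exP => eps eps0.
have [N _ /(_ N (leqnn N)) bN] := cvgr_lt _ b0 _ eps0.
exists (x_ N); exists N => // m /= Nm.
by rewrite -ball_normE /ball_ /= distrC (le_lt_trans (xb _ _ Nm)).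
Qed.

(** Ekeland's variational principle for a continuous function. The relation
    f y + eps |y - x| <= f x is a partial order with closed lower sets [S x].
    Going down this order, each time almost to the infimum of f over the
    current lower set, leaves lower sets of diameter tending to zero; their
    common point u is minimal, which is the second property. *)
Lemma ekeland (R : realType) (V : completeNormedModType R) (f : V -> R)
    (eps : R) (x0 : V) :
  continuous f -> has_lbound (range f) -> 0 < eps ->
  exists u, f u + eps * `|u - x0| <= f x0 /\
            forall v, f u <= f v + eps * `|v - u|.
Proof.
move=> fcont [b fb] eps0.
pose S x := [set y | f y + eps * `|y - x| <= f x].
have Sxx x : S x x by rewrite /S /= subrr normr0 mulr0 addr0.
have Strans x y z : S x y -> S y z -> S x z.
  rewrite /S /= => Sxy Syz.
  have : eps * `|z - x| <= eps * `|z - y| + eps * `|y - x|.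
    by rewrite -mulrDr ler_pM2l// ler_distD.
  lra.
have Sclosed x : closed (S x).
  have -> : S x = (fun y => f y + eps * `|y - x|) @^-1` [set r | r <= f x] by [].
  apply: preimage_closed; last exact: closed_le.
  move=> y _; apply: cvgD; first exact: fcont.
  apply: cvgMr; apply: cvg_norm; apply: cvgB; [exact: cvg_id|exact: cvg_cst].
(* The first component of p is the step number, which sets the tolerance, so
   that a single choice function drives the whole recursion. *)
have next (p : nat * V) :
    exists y, S p.2 y /\ forall v, S p.2 v -> f y - f v <= harmonic p.1.
  have infS : has_inf (f @` S p.2).
    split; first by exists (f p.2), p.2.
    by exists b => _ [y _ <-]; apply: fb; exists y.
  have [_ [y Sy <-] fy] := inf_adherent (harmonic_gt0 p.1 : 0 < _ :> R) infS.
  exists y; split=> // v Sv.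
  have : inf (f @` S p.2) <= f v by apply: ge_inf; [exact: infS.2|exists v].
  lra.
have [g gP] := choice next.
pose x_ := fix x_ n := if n is m.+1 then g (m, x_ m) else x0.
have xS n m : (n <= m)%N -> S (x_ n) (x_ m).
  move=> /subnK <-; elim: (m - n)%N => [|k IH]; first exact: Sxx.
  exact: Strans IH (gP (_, _)).1.
(* Everything below x_(n+1) is within the tolerance of step n, hence close to
   x_(n+1): the drop of f pays for the distance. *)
have close n v : S (x_ n.+1) v -> eps * `|v - x_ n.+1| <= harmonic n.
  move=> Sv; have fxv : f (x_ n.+1) - f v <= harmonic n.
    exact: (gP (n, x_ n)).2 v (Strans _ _ _ (xS _ _ (leqnSn n)) Sv).
  by rewrite (le_trans _ fxv)// lerBrDl.
have hcvg : eps^-1 * harmonic n @[n --> \oo] --> (0 : R).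
  by rewrite -(mulr0 eps^-1); apply: cvgMr; exact: cvg_harmonic.
have /cvg_ex[u xu] : cvg (x_ n.+1 @[n --> \oo]).
  apply: cvg_of_tail_bound hcvg _ => n m nm.
  by rewrite ler_pdivlMl//; apply: close; exact: (xS n.+1 m.+1).
have Su n : S (x_ n) u.
  apply: (closed_cvg (S (x_ n)) (Sclosed (x_ n)) _ u xu).
  by exists n => // m /= nm; apply: (xS n m.+1); exact: leqW.
exists u; split=> [|v]; first exact: (Su 0).
rewrite leNgt; apply/negP => fv.
(* A point strictly violating minimality lies in all the lower sets, so the
   sequence converges to it as well as to u. *)
have Sv : S u v by exact: ltW.
have xv : x_ n.+1 @[n --> \oo] --> v.
  apply/cvgrPdist_le => e e0.
  apply: filterS (cvgr_le _ hcvg _ e0) => n; apply: le_trans.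
  by rewrite ler_pdivlMl//; apply: close; exact: Strans Sv.
have uv : u = v by apply: (cvg_unique _ xu xv); exact: norm_hausdorff.
by move: fv; rewrite uv subrr normr0 mulr0 addr0 ltxx.
Qed.

(** The lower bound on the difference quotients at u survives in the limit along
    positive parameters t, where dividing by t keeps the inequality. *)
Lemma diff_ge_of_slope (R : realType) (V : normedModType R) (f : V -> R)
    (c : R) (u : V) :
  differentiable f u -> (forall v, f u <= f v + c * `|v - u|) ->
  forall h, - (c * `|h|) <= 'd f u h.
Proof.
move=> df slope h; rewrite -deriveE//.
have /cvg_dnbhs_at_right dfh := diff_derivable (v := h) df.
apply: (cvgr_to_ge dfh); near=> t.
have t0 : 0 < t by near: t; exact: nbhs_right_gt.
rewrite /= -[_ *: _]/(_ * _) ler_pdivlMl//.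
have := slope (t *: h + u).
rewrite addrK normrZ (gtr0_norm t0) /=; lra.
Unshelve. all: by end_near. Qed.

Lemma le_dual_norm (R : realType) (V : normedModType R) (f : V -> R) (h : V) :
  `|h| <= 1 -> (`|f h|%:E <= dual_norm f)%E.
Proof. by move=> h1; apply: ereal_sup_ubound; exists h. Qed.

(** Comparison with the value at the origin, which lies in every nonempty
    centred ball. *)
Lemma locally_lipschitz_bounded (R : realType) (V W : normedModType R)
    (T : V -> W) (r : R) : locally_lipschitz T ->
  exists2 M, 0 < M & forall u, `|u| <= r -> `|T u| <= M.
Proof.
move=> Tlip; pose A := [set u : V | `|u| <= r].
have bA : bounded_set A.
  by exists r; split=> [|M /ltW rM u /le_trans]; [exact: num_real|exact].
have [k Tk] : exists k, k.-lipschitz_A T.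
  by have [k [_ Tk]] := Tlip A bA; exists (k + 1); apply: Tk; rewrite ltrDl.
(* The absolute values allow k or r to be negative, and the final 1 makes the
   bound positive. *)
exists (`|k| * `|r| + `|T 0| + 1).
  by rewrite ltr_wpDl// addr_ge0// mulr_ge0.
move=> u ur.
have A0 : A 0 by rewrite /A /= normr0 (le_trans _ ur).
have := Tk (u, 0) (conj ur A0); rewrite /= subr0 => Tu.
have : `|T u| <= `|T u - T 0| + `|T 0| by rewrite -{1}(subrK (T 0) (T u)) ler_normD.
have : k * `|u| <= `|k| * `|r|.
  rewrite (le_trans (ler_norm _))// normrM normr_id ler_wpM2l//.
  by rewrite (le_trans ur)// ler_norm.
lra.
Qed.

(** The dual norm is a supremum over the unit ball, so it is tested on T u / M,
    where M bounds T along the sequence: this yields (d / M) E(u) <= |E'(u)|. *)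
Lemma small_derivative_of_pairing (R : realType) (V : normedModType R)
    (E : V -> R) (T : V -> V) (d : R) :
  (forall u, 0 <= E u) -> (forall u, differentiable E u) ->
  locally_lipschitz T -> 0 < d ->
  (forall u, 'd E u (T u) = - d * E u) -> small_derivative_behavior E.
Proof.
move=> E0 dE Tlip d0 ET u_ ub /fine_cvgP[fin cv].
have [r ur] : exists r, forall j, `|u_ j| <= r.
  have [r [_ ur]] := ub; exists (r + 1) => j.
  by apply: (ur (r + 1)); rewrite ?ltrDl.
have [M M0 TM] := locally_lipschitz_bounded r Tlip.
have bound j : ((d / M * E (u_ j))%:E <= dual_norm ('d E (u_ j)))%E.
  have : `|M^-1 *: T (u_ j)| <= 1.
    by rewrite normrZ normfV (gtr0_norm M0) ler_pdivrMl// mulr1 TM// ur.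
  move=> /(le_dual_norm ('d E (u_ j))); apply: le_trans.
  rewrite lee_fin linearZ /= ET -[_ *: _]/(_ * _) -normrN.
  by rewrite (le_trans _ (ler_norm _))//; lra.
have cvM : M / d * fine (dual_norm ('d E (u_ j))) @[j --> \oo] --> 0.
  by rewrite -(mulr0 (M / d)); exact: cvgMr.
apply: (squeeze_cvgr _ (cvg_cst 0) cvM).
apply: filterS fin => j finj; rewrite E0 /=.
have : d / M * E (u_ j) <= fine (dual_norm ('d E (u_ j))).
  by rewrite -lee_fin fineK.
rewrite -ler_pdivlMl ?divr_gt0// invf_div; exact.
Qed.

(** With M fixed by the sublevel set of E(0), applying Ekeland's principle with
    eps = d e / M turns d E(u) <= eps M into E(u) <= e. *)
Lemma exists_small_value (R : realType) (V : completeNormedModType R)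
    (E : V -> R) (C : R) (T : V -> V) (d : R) :
  (forall u, 0 <= E u) -> (forall u, differentiable E u) ->
  (forall u v, `|u - v| ^+ 2 <= C * (E u + E v)) ->
  locally_lipschitz T -> 0 < d ->
  (forall u, 'd E u (T u) = - d * E u) ->
  forall e, 0 < e -> exists u, E u <= e.
Proof.
move=> E0 dE coer Tlip d0 ET e e0.
(* Coercivity against 0 puts the points with E u <= E 0 in this ball. *)
have [M M0 TM] := locally_lipschitz_bounded (Num.sqrt (`|C| * (E 0 + E 0))) Tlip.
have Econt : continuous E by move=> x; exact: differentiable_continuous.
have Elb : has_lbound (range E) by exists 0 => _ [x _ <-].
have eps0 : 0 < d * e / M by rewrite divr_gt0// mulr_gt0.
have [u [u0 slope]] := ekeland 0 Econt Elb eps0.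
exists u.
have Eu0 : E u <= E 0 by rewrite (le_trans _ u0)// lerDl mulr_ge0// ltW.
have TuM : `|T u| <= M.
  apply: TM; rewrite -(normr_id u) -sqrtr_sqr ler_wsqrtr//.
  have := coer u 0; rewrite subr0 => /le_trans; apply.
  rewrite (le_trans (ler_wpM2r _ (ler_norm C))) ?addr_ge0//.
  by rewrite ler_wpM2l// lerD2r.
have := diff_ge_of_slope (dE u) slope (T u); rewrite ET mulNr lerN2 => dEu.
rewrite -(ler_pM2l d0) (le_trans dEu)// -[leRHS](divfK (lt0r_neq0 M0)).
by rewrite ler_wpM2l// ltW.
Qed.

(** Coercivity turns smallness of E into closeness of points, so a sequence with
    E -> 0 is Cauchy. *)
Lemma exists_zero (R : realType) (V : completeNormedModType R)
    (E : V -> R) (C : R) (T : V -> V) (d : R) :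
  (forall u, 0 <= E u) -> (forall u, differentiable E u) -> 0 < C ->
  (forall u v, `|u - v| ^+ 2 <= C * (E u + E v)) ->
  locally_lipschitz T -> 0 < d ->
  (forall u, 'd E u (T u) = - d * E u) ->
  exists u, E u = 0.
Proof.
move=> E0 dE C0 coer Tlip d0 ET.
(* With this bound on the values, coercivity gives exactly
   |x_m - x_n|^2 <= (harmonic n)^2 for n <= m. *)
have e0 n : 0 < harmonic n ^+ 2 / (C + C) :> R.
  by rewrite divr_gt0 ?addr_gt0// exprn_gt0// harmonic_gt0.
have [x_ xP] :=
  choice (fun n => exists_small_value E0 dE coer Tlip d0 ET (e0 n)).
have xE n m : (n <= m)%N -> E (x_ m) <= harmonic n ^+ 2 / (C + C).
  move=> nm; rewrite (le_trans (xP m))// ler_pM2r ?invr_gt0 ?addr_gt0//.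
  by rewrite ler_sqr ?nnegrE ?invr_ge0// lef_pV2 ?posrE// ler_nat.
have /cvg_ex[u xu] : cvgn x_.
  apply: (cvg_of_tail_bound cvg_harmonic) => n m nm.
  rewrite -ler_sqr ?nnegrE ?harmonic_ge0//.
  rewrite (le_trans (coer _ _))//.
  have := lerD (xE n m nm) (xE n n (leqnn n)).
  rewrite -(ler_pM2l C0) => /le_trans; apply.
  suff halves x : C * (x / (C + C) + x / (C + C)) = x by rewrite halves.
  by field; rewrite gt_eqF ?addr_gt0.
exists u; apply/le_anti; rewrite E0 andbT.
have Exu : E (x_ n) @[n --> \oo] --> E u.
  exact: continuous_cvg (differentiable_continuous (dE u)) xu.
have b0 : harmonic n ^+ 2 / (C + C) @[n --> \oo] --> (0 : R).
  rewrite -[0](mul0r (C + C)^-1) -[X in X * _](mulr0 0); apply: cvgMl.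
  by apply: cvgM; exact: cvg_harmonic.
by apply: (ler_cvg_to Exu b0); apply: nearW => n.
Qed.

Theorem proposition1p6 (R : realType) (H : completeNormedModType R)
  (inner : {dot H for idfun})
  (innerE : forall u : H, `|u| ^+ 2 = inner u u)
  (E : H -> R) (E_ge0 : forall u, 0 <= E u) (E_C1 : C1_functional E)
  (C0 : R) (C0_gt0 : 0 < C0)
  (E_coercive : forall u v : H, `|u - v| ^+ 2 <= C0 * (E u + E v))
  (T : H -> H) (T_lip : locally_lipschitz T)
  (d : R) (d_gt0 : 0 < d)
  (ET : forall u : H, 'd E u (T u) = - d * E u) :
  error_functional E /\
  exists u_inf : H,
    [/\ E u_inf = 0,
        unique (global_minimizer E) u_inf &
        exists C : R, forall u : H, `|u - u_inf| ^+ 2 <= C * E u].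
Proof.
have [dE _] := E_C1.
split.
  split=> //; last by exists C0.
  exact: small_derivative_of_pairing ET.
have [u u0] := exists_zero E_ge0 dE C0_gt0 E_coercive T_lip d_gt0 ET.
have dist v : `|v - u| ^+ 2 <= C0 * E v.
  by rewrite (le_trans (E_coercive v u))// u0 addr0.
exists u; split=> //; last by exists C0.
split=> [v|v vmin]; first by rewrite u0.
apply/eqP; rewrite eq_sym -subr_eq0 -normr_eq0 -sqrf_eq0 eq_le sqr_ge0 andbT.
have := dist v; have := vmin u; rewrite u0 => Ev0.
by have -> : E v = 0; [apply/le_anti; rewrite Ev0 E_ge0|rewrite mulr0].
Qed.
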